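(* Let $X_1,X_2,\dots$ be independent normally distributed random variables with $\mathbb{E}[X_i]=\mu_i$ and $\mathbb{E}[|X_i-\mu_i|^2]=\nu_i>0$ for $i\in\mathbb{N}$. Define $S_n=\sum_{i=1}^nX_i$, $\overline{\mu}_n=\frac1n\sum_{i=1}^n\mu_i$, $\overline{\nu}_n=\frac1n\sum_{i=1}^n\nu_i$, and $\mathcal{V}(s,n)=n\big(\overline{\mu}_ns+\frac{\overline{\nu}_ns^2}{2}\big)$ for $s\in\mathbb{R}$, $n\in\mathbb{N}$. Then for every positive integer $m$ and all $\theta\in\mathbb{R}$, \[ \Pr\Big\{\sup_{n\in\mathbb{N}}\big[\zeta(S_n-m\theta)-\mathcal{V}(\zeta,n)+\mathcal{V}(\zeta,m)\big]\ge0\Big\}\le\Big[\exp\Big(-\frac{|\theta-\overline{\mu}_m|^2}{2\overline{\nu}_m}\Big)\Big]^m, \] where $\zeta=\frac{\theta-\overline{\mu}_m}{\overline{\nu}_m}$.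
   Context: $\mathbb{N}$ denotes the set of positive integers. *)

(* Defs.v *)
From HB Require Import structures.
From mathcomp Require Import all_boot all_order all_algebra.
From mathcomp Require Import all_classical all_reals all_analysis.
Set Implicit Arguments. Unset Strict Implicit. Unset Printing Implicit Defensive.
Import Order.TTheory GRing.Theory Num.Theory.
Local Open Scope classical_set_scope.
Local Open Scope ring_scope.

Definition mutually_independent_RVs {d} {T : measurableType d} {R : realType}
  (P : probability T R) (X : nat -> {RV P >-> R}) : Prop :=
  forall (s : seq nat) (B : nat -> set R),
    uniq s -> (forall j, j \in s -> measurable (B j)) ->
    P (\bigcap_(j in [set j | j \in s]) (X j @^-1` B j)) =
    (\big[*%E/1%E]_(j <- s) P (X j @^-1` B j))%E.

(* averages over the first n terms (0-indexed: term i stands for index i+1) *)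
Definition avg {R : realType} (a : nat -> R) (n : nat) : R :=
  (\sum_(i < n) a i) / n%:R.

Definition Vfun {R : realType} (mu nu : nat -> R) (s : R) (n : nat) : R :=
  n%:R * (avg mu n * s + avg nu n * s ^+ 2 / 2).
Arguments mutually_independent_RVs {d T R} P X.

(* Main.v *)
(* Put M_n = exp(zeta S_n - V(zeta, n)), a product of independent nonnegative
   factors of mean 1. Freezing this product once it reaches a level e > 0 keeps
   its mean equal to 1, so Markov's inequality gives Ville's inequality
   P(exists n, M_n >= e) <= 1/e. The n-th term of the supremum is ln (M_n / c)
   with c = exp(m zeta theta - V(zeta, m)), and the choice of zeta makes 1/c the
   asserted bound. As the supremum need not be attained, Ville's inequality is
   applied at every e < c, and then e tends to c. *)
Require Import Defs.
From HB Require Import structures.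
From mathcomp Require Import all_boot all_order all_algebra.
From mathcomp Require Import all_classical all_reals all_analysis.
From mathcomp Require Import measurable_realfun ring.
Set Implicit Arguments.
Unset Strict Implicit.
Unset Printing Implicit Defensive.
Import Order.TTheory GRing.Theory Num.Theory.
Local Open Scope classical_set_scope.
Local Open Scope ring_scope.

(** * Integrals against the normal law *)

(** Change of variables along the Radon-Nikodym derivative, which agrees almost everywhere with
    [normal_pdf] because both have the same integral over every measurable set. *)
Lemma normal_prob_integral (R : realType) (m s : R) (f : R -> \bar R) :
  measurable_fun setT f -> (forall x, 0 <= f x)%E ->
  (\int[normal_prob m s]_x f x
   = \int[lebesgue_measure]_x (f x * (normal_pdf m s x)%:E))%E.
Proof.
move=> mf f0.
have dom := normal_prob_dominates m s.
have mpdf : measurable_fun [set: R] (fun x => (normal_pdf m s x)%:E).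
  by apply/measurable_EFinP; exact: measurable_normal_pdf.
pose g := Radon_Nikodym_SigmaFinite.f (normal_prob m s) lebesgue_measure.
have ig : lebesgue_measure.-integrable [set: R] g.
  exact: Radon_Nikodym_SigmaFinite.f_integrable.
rewrite -(Radon_Nikodym_SigmaFinite.change_of_variables dom f0)//.
apply: ae_eq_integral => //.
- by apply: emeasurable_funM => //; exact: measurable_int ig.
- exact: emeasurable_funM.
- apply: ae_eqe_mul2l; apply: integral_ae_eq => // E _ mE.
  by rewrite -Radon_Nikodym_SigmaFinite.f_integral.
Qed.

(* Completing the square: exponential tilting shifts the mean. *)
Lemma normal_pdf_tilt (R : realType) (m s z x : R) : s != 0 ->
  expR (z * x - (m * z + s ^+ 2 * z ^+ 2 / 2)) * normal_pdf m s x
  = normal_pdf (m + s ^+ 2 * z) s x.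
Proof.
move=> s0; rewrite !normal_pdfE// /normal_fun mulrCA -expRD.
congr (_ * expR _); rewrite -mulr_natl; field.
by rewrite s0.
Qed.

(** The tilted density is again a normal density, so its total mass is 1. *)
Lemma normal_prob_mgf (R : realType) (m s z : R) : s != 0 ->
  (\int[normal_prob m s]_x
    (expR (z * x - (m * z + s ^+ 2 * z ^+ 2 / 2)))%:E = 1)%E.
Proof.
move=> s0; rewrite normal_prob_integral//; last first.
  apply/measurable_EFinP; apply: measurableT_comp => //.
  by apply: measurable_funB => //; exact: measurable_funM.
under eq_integral do rewrite -EFinM normal_pdf_tilt//.
exact: integral_normal_pdf.
Qed.

(* [normal_prob] lives on [measurableTypeR R] and distributions on [R]: the two
   have the same measurable sets but are different measurable types, hence the
   transfer along the identity. *)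
Lemma normal_distribution_integral d (T : measurableType d) (R : realType)
    (P : probability T R) (Y : {RV P >-> R}) (m s : R) (f : R -> \bar R) :
  (forall A, measurable A -> distribution P Y A = normal_prob m s A) ->
  measurable_fun setT f -> (forall x, 0 <= f x)%E ->
  (\int[distribution P Y]_x f x = \int[normal_prob m s]_x f x)%E.
Proof.
move=> distY mf f0.
have mid : @measurable_fun _ _ (measurableTypeR R) R setT (fun x => x) by [].
pose idR := @mfun_Sub _ _ (measurableTypeR R) R _ (mem_set mid).
transitivity (\int[distribution (normal_prob m s) idR]_x f x)%E.
  by apply: eq_measure_integral => A mA _; exact: distY.
exact: ge0_integral_distribution.
Qed.

(** * Independence of the past and the next variable *)

(** Both sides are finite measures in [A]; they agree on a pi-system containing the whole space,
    hence on the sigma-algebra it generates. *)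
Lemma pi_system_indep d (T : measurableType d) (R : realType)
    (P : probability T R) (G : set (set T)) (B : set T) :
  G `<=` measurable -> G setT -> setI_closed G -> measurable B ->
  (forall A, G A -> P (A `&` B) = P A * P B)%E ->
  forall A, <<s G >> A -> (P (A `&` B) = P A * P B)%E.
Proof.
move=> Gm GT GI mB indep A sGA.
have PBfin : P B \is a fin_num by exact: fin_num_measure.
have PB0 : 0 <= fine (P B) by rewrite fine_ge0.
have UT : \bigcup_(k : nat) [set: T] = setT.
  by apply/seteqP; split => // w _; exists 0%N.
have E C : mscale (NngNum PB0) P C = (P C * P B)%E.
  by rewrite /mscale/= fineK// muleC.
rewrite -E -[LHS]/(mrestr P mB A).
move: A sGA; apply: (g_sigma_algebra_measure_unique G Gm (fun=> setT) (fun=> GT)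
  UT [the measure _ _ of mrestr P mB]
  [the measure _ _ of mscale (NngNum PB0) P]) => // [C GC|_].
  by rewrite [RHS]E; exact: indep.
by rewrite /= /mrestr setTI ltey_eq PBfin.
Qed.

(** A pi-system generating the past of [X k], in the rectangular form to which
    [mutually_independent_RVs] applies directly. *)
Definition cylinders {d} {T : measurableType d} {R : realType}
    (X : nat -> T -> R) (k : nat) : set (set T) :=
  [set \bigcap_(j in [set j | j \in iota 0 k]) (X j @^-1` B j)
    | B in [set B | forall j, measurable (B j)]].

Section cylinders.
Context d (T : measurableType d) (R : realType) (P : probability T R).
Variable X : nat -> {RV P >-> R}.
Hypothesis indepX : mutually_independent_RVs P X.

Lemma cylinders_measurable k : cylinders X k `<=` measurable.
Proof.
move=> _ [B mB <-]; apply: fin_bigcap_measurable => [|j _].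
  exact: finite_seq.
exact: measurable_funPTI.
Qed.

Lemma cylindersT k : cylinders X k setT.
Proof. by exists (fun=> setT) => //; apply/seteqP; split. Qed.

Lemma cylindersI k : setI_closed (cylinders X k).
Proof.
move=> _ _ [B mB <-] [C mC <-]; exists (fun j => B j `&` C j) => [j|].
  exact: measurableI.
by rewrite -bigcapI.
Qed.

Lemma cylinders_preimage k j B : (j < k)%N -> measurable B ->
  cylinders X k (X j @^-1` B).
Proof.
move=> jk mB; exists (fun i => if i == j then B else setT).
  by move=> i; case: ifP.
apply/seteqP; split => [w /(_ j)|w Bw i _ /=].
  by rewrite /= eqxx; apply; rewrite mem_iota.
by case: eqP => [->|].
Qed.

Lemma cylinders_indep k A B : cylinders X k A -> measurable B ->
  (P (A `&` X k @^-1` B) = P A * P (X k @^-1` B))%E.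
Proof.
move=> [C mC <-] mB.
(* The cylinder does not constrain index [k], so side [k] is free to be [B]; independence is then
   used for the same [D] on [iota 0 k.+1] and on [iota 0 k]. *)
pose D j := if j == k then B else C j.
have mD j : measurable (D j) by rewrite /D; case: ifP.
have Dk : D k = B by rewrite /D eqxx.
have DC j : j \in iota 0 k -> D j = C j.
  rewrite mem_iota /D => /andP[_]; rewrite add0n.
  by case: eqP => // ->; rewrite ltnn.
have -> : \bigcap_(j in [set j | j \in iota 0 k]) (X j @^-1` C j) =
          \bigcap_(j in [set j | j \in iota 0 k]) (X j @^-1` D j).
  by apply: eq_bigcapr => j /= jk; rewrite DC.
have := @indepX (iota 0 k.+1) D (iota_uniq _ _) (fun j _ => mD j).
rewrite -addn1 iotaD add0n big_cat big_seq1 Dk.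
rewrite -(@indepX (iota 0 k) D (iota_uniq _ _) (fun j _ => mD j)) => <-.
congr (P _); apply/seteqP; split => w /=.
  move=> [wD wB] j /=; rewrite mem_cat inE => /orP[/wD//|/eqP->].
  by rewrite Dk.
move=> wD; split => [j jk|]; last first.
  by have := wD k; rewrite /= mem_cat mem_seq1 eqxx orbT Dk; apply.
by apply: wD; rewrite /= mem_cat [j \in _]jk.
Qed.


Lemma cylinders_generated_indep k A B : <<s cylinders X k >> A ->
  measurable B ->
  (P (A `&` X k @^-1` B) = P A * P (X k @^-1` B))%E.
Proof.
move=> kA mB; apply: (@pi_system_indep _ _ _ P (cylinders X k)) => //.
- exact: cylinders_measurable.
- exact: cylindersT.
- exact: cylindersI.
- exact: measurable_funPTI.
- by move=> C kC; exact: cylinders_indep.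
Qed.

End cylinders.

(** The joint law agrees with the product of the marginals on rectangles, hence everywhere; Tonelli
    then splits the integral. *)
Lemma indep_integral_pair d (T : measurableType d) (R : realType)
    (P : probability T R) (U V : {RV P >-> R}) (f : R * R -> \bar R) :
  (forall A B, measurable A -> measurable B ->
    (P (U @^-1` A `&` V @^-1` B) = P (U @^-1` A) * P (V @^-1` B))%E) ->
  measurable_fun setT f -> (forall z, 0 <= f z)%E ->
  (\int[P]_w f (U w, V w)
   = \int[distribution P U]_u \int[distribution P V]_v f (u, v))%E.
Proof.
move=> indep mf f0.
have mUV : measurable_fun setT (fun w => (U w, V w)).
  exact: measurable_fun_pair.
pose UV : {mfun T >-> (R * R)%type} := mfun_Sub (mem_set mUV).
transitivity (\int[distribution P UV]_z f z)%E.
  by rewrite ge0_integral_distribution.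
transitivity (\int[distribution P U \x distribution P V]_z f z)%E; last first.
  exact: fubini_tonelli1.
apply: eq_measure_integral => A mA _.
by apply/esym/product_measure_unique => // B C mB mC; exact: indep.
Qed.

(* The product of the [phi i (X i)], frozen once it reaches [c]. Whether it is
   frozen can be read off its current value, so each step depends only on the
   pair (current value, X n). *)
Fixpoint stopped {T : Type} {R : realType} (c : R) (phi : nat -> R -> R)
    (X : nat -> T -> R) (n : nat) (w : T) : R :=
  if n is k.+1 then
    stopped c phi X k w *
    (if c <= stopped c phi X k w then 1 else phi k (X k w))
  else 1.

Lemma measurable_stopped d (T : measurableType d) (R : realType) (c : R)
    (phi : nat -> R -> R) (X : nat -> T -> R) (n : nat) :
  (forall k, measurable_fun setT (phi k)) ->
  (forall k, (k < n)%N -> measurable_fun setT (X k)) ->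
  measurable_fun setT (stopped c phi X n).
Proof.
move=> mphi; elim: n => [|n IH] mX //=.
have mW : measurable_fun setT (stopped c phi X n).
  by apply: IH => k kn; apply: mX; exact: ltnW.
apply: measurable_funM => //; apply: measurable_fun_ifT => //.
- exact: measurable_fun_ler.
- by apply: measurableT_comp => //; exact: mX.
Qed.

Lemma stopped_ge0 (T : Type) (R : realType) (c : R) (phi : nat -> R -> R)
    (X : nat -> T -> R) n w :
  (forall k x, 0 <= phi k x) -> 0 <= stopped c phi X n w.
Proof.
move=> phi0; elim: n => [|n IH] /=; first exact: ler01.
by apply: mulr_ge0 => //; case: ifP.
Qed.

Lemma stopped_nondecreasing_event (T : Type) (R : realType) (c : R)
    (phi : nat -> R -> R) (X : nat -> T -> R) :
  nondecreasing_seq (fun n => [set w | c <= stopped c phi X n w]).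
Proof.
apply/nondecreasing_seqP => n; apply/subsetPset => w /= cw.
by rewrite cw mulr1.
Qed.

Lemma stopped_prod (T : Type) (R : realType) (c : R) (phi : nat -> R -> R)
    (X : nat -> T -> R) n w :
  c <= \prod_(i < n) phi i (X i w) -> c <= stopped c phi X n w.
Proof.
move=> cM.
(* Either the level has been reached, and the value is frozen above it, or no factor has been
   dropped yet. *)
suff [//|->//] : c <= stopped c phi X n w \/
    stopped c phi X n w = \prod_(i < n) phi i (X i w).
elim: n {cM} => [|n IH]; first by right; rewrite big_ord0.
rewrite /= big_ord_recr /=; case: ifPn => [cW|ncW].
  by left; rewrite mulr1.
by right; case: IH => [cW|-> //]; rewrite cW in ncW.
Qed.

Lemma measurable_superlevel d (T : measurableType d) (R : realType)
    (f : T -> R) (c : R) :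
  measurable_fun setT f -> measurable [set w | c <= f w].
Proof.
by move=> mf; rewrite -[X in measurable X]setTI -preimage_itvcy; exact: mf.
Qed.

(** * Ville's inequality *)

Section ville.
Context d (T : measurableType d) (R : realType) (P : probability T R).
Variables (X : nat -> {RV P >-> R}) (phi : nat -> R -> R).
Hypothesis indepX : mutually_independent_RVs P X.
Hypothesis mphi : forall k, measurable_fun setT (phi k).
Hypothesis phi_ge0 : forall k x, 0 <= phi k x.
Hypothesis phi_mean : forall k,
  (\int[distribution P (X k)]_x (phi k x)%:E = 1)%E.

(** Given the current value, the next factor has mean 1 in both cases: it is the constant 1 when
    frozen, and otherwise [phi n (X n)] with [X n] independent of that value. *)
Lemma stopped_mean c n : (\int[P]_w (stopped c phi X n w)%:E = 1)%E.
Proof.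
elim: n => [|n IH] /=.
  by rewrite integral_cst// mul1e; exact: probability_setT.
have mW : measurable_fun setT (stopped c phi X n).
  exact: measurable_stopped.
pose W : {RV P >-> R} := mfun_Sub (mem_set mW).
have indepW A B : measurable A -> measurable B ->
    (P (W @^-1` A `&` X n @^-1` B) = P (W @^-1` A) * P (X n @^-1` B))%E.
  move=> mA mB; apply: cylinders_generated_indep => //.
  (* The chain at time [n] reads only the variables before [X n], so it is measurable for the
     sigma-algebra generated by the cylinders. *)
  rewrite -[_ @^-1` _]setTI.
  apply: (@measurable_stopped _ (g_sigma_algebraType (cylinders X n)) R c
    phi X n mphi) => // k kn _ C mC.
  by rewrite setTI; apply: sub_sigma_algebra; exact: cylinders_preimage.
(* [`|z.1|] keeps the integrand nonnegative off the range of the chain *)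
pose f (z : R * R) := (`|z.1| * (if c <= z.1 then 1 else phi n z.2))%:E.
have mf : measurable_fun setT f.
  apply/measurable_EFinP; apply: measurable_funM.
    exact: measurableT_comp.
  apply: measurable_fun_ifT => //.
    exact: measurable_fun_ler.
  exact: measurableT_comp.
have f0 z : (0 <= f z)%E by rewrite lee_fin mulr_ge0//; case: ifP.
transitivity (\int[P]_w f (W w, X n w))%E.
  by apply: eq_integral => w _; rewrite /f /= ger0_norm// stopped_ge0.
rewrite (indep_integral_pair indepW mf f0).
transitivity (\int[distribution P W]_u `|u|%:E)%E.
  apply: eq_integral => u _; rewrite /f /=.
  under eq_integral do rewrite EFinM.
  rewrite ge0_integralZl//; last 2 first.
  - by apply/measurable_EFinP; case: (c <= u).
  - by move=> x _; rewrite lee_fin; case: (c <= u).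
  case: (c <= u); last by rewrite phi_mean mule1.
  rewrite integral_cst// mul1e -[RHS]mule1; congr (_ * _)%E.
  exact: (@probability_setT _ _ _ (distribution P (X n))).
rewrite ge0_integral_distribution//; last first.
  by apply/measurable_EFinP; exact: normr_measurable.
rewrite -IH; apply: eq_integral => w _ /=.
by rewrite ger0_norm// stopped_ge0.
Qed.

Lemma stopped_tail c n : 0 < c ->
  (P [set w | (c <= stopped c phi X n w)%R] <= (c^-1)%:E)%E.
Proof.
move=> c0.
have mW : measurable_fun setT (EFin \o stopped c phi X n).
  by apply/measurable_EFinP; exact: measurable_stopped.
(* Markov's inequality. *)
have := le_integral_abse P measurableT mW c0; rewrite setTI.
have W0 w : (`|(EFin \o stopped c phi X n) w| = (stopped c phi X n w)%:E)%E.
  by rewrite /= ger0_norm// stopped_ge0.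
under eq_integral do rewrite W0.
under eq_set do rewrite W0 lee_fin.
by rewrite stopped_mean -[(c^-1)%:E]mule1 lee_pdivlMl.
Qed.

(** Freezing makes the events increase with [n], so the probability of their union is a limit of
    tails, each at most [c^-1]. *)
Lemma ville_inequality c : 0 < c ->
  (P (\bigcup_n [set w | (c <= \prod_(i < n) phi i (X i w))%R]) <= (c^-1)%:E)%E.
Proof.
move=> c0.
pose F n := [set w | c <= stopped c phi X n w].
have mF n : measurable (F n).
  by apply: measurable_superlevel; exact: measurable_stopped.
have PF : (P (\bigcup_n F n) <= (c^-1)%:E)%E.
  have cvgF := nondecreasing_cvg_mu (mu := P) mF (bigcupT_measurable _ mF)
    (@stopped_nondecreasing_event _ _ c phi X).
  rewrite -(cvg_lim _ cvgF)//; apply: lime_le; first exact: cvgP cvgF.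
  by apply: nearW => n; exact: stopped_tail.
apply: le_trans PF; apply: le_measure; rewrite ?inE.
- apply: bigcupT_measurable => n; apply: measurable_superlevel.
  by apply: measurable_prod => i _; exact: measurableT_comp.
- exact: bigcupT_measurable.
- by move=> w [n _ cM]; exists n => //; exact: stopped_prod.
Qed.

End ville.

(** * The bound on the supremum *)

Lemma avg_gt0 (R : realType) (a : nat -> R) n :
  (forall i, 0 < a i) -> (0 < n)%N -> 0 < avg a n.
Proof.
case: n => // n a0 _; rewrite divr_gt0 ?ltr0n//.
by rewrite big_ord_recl ltr_pwDl// sumr_ge0// => i _; exact: ltW.
Qed.

Theorem theorem17 (d : measure_display) (T : measurableType d) (R : realType)
  (P : probability T R) (X : nat -> {RV P >-> R}) (mu nu : nat -> R) :
  mutually_independent_RVs P X ->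
  (forall i, 0 < nu i) ->
  (forall i A, measurable A ->
     distribution P (X i) A = normal_prob (mu i) (Num.sqrt (nu i)) A) ->
  forall (m : nat) (theta : R), (0 < m)%N ->
  let zeta := (theta - avg mu m) / avg nu m in
  let S := fun (n : nat) (w : T) => \sum_(i < n) X i w in
  (P [set w | (0 <= ereal_sup
       [set ((zeta * (S n w - m%:R * theta) - Vfun mu nu zeta n
              + Vfun mu nu zeta m)%:E) | n in [set n : nat | (0 < n)%N]])%E]
   <= ((expR (- (`|theta - avg mu m| ^+ 2) / (2 * avg nu m))) ^+ m)%:E)%E.
Proof.
move=> indepX nu0 distX m theta m0.
set zeta := (theta - avg mu m) / avg nu m.
pose S n w := \sum_(i < n) X i w.
pose phi i x := expR (zeta * x - (mu i * zeta + nu i * zeta ^+ 2 / 2)).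
pose g n w : R := zeta * (S n w - m%:R * theta) - Vfun mu nu zeta n
              + Vfun mu nu zeta m.
pose E := [set w | (0 <= ereal_sup
  [set (g n w)%:E | n in [set n : nat | (0 < n)%N]])%E].
change (P E
  <= (expR (- (`|theta - avg mu m| ^+ 2) / (2 * avg nu m)) ^+ m)%:E)%E.
pose c := expR (zeta * (m%:R * theta) - Vfun mu nu zeta m).
have c0 : 0 < c by exact: expR_gt0.
have mphi i : measurable_fun setT (phi i).
  apply: measurableT_comp => //.
  by apply: measurable_funB => //; exact: measurable_funM.
have phi0 i x : 0 <= phi i x by exact: expR_ge0.
have phi1 i : (\int[distribution P (X i)]_x (phi i x)%:E = 1)%E.
  have s0 : Num.sqrt (nu i) != 0 by rewrite gt_eqF// sqrtr_gt0.
  rewrite -(normal_prob_mgf (mu i) zeta s0) sqr_sqrtr; last exact: ltW.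
  apply: normal_distribution_integral.
  - exact: distX.
  - exact/measurable_EFinP.
  - by move=> x; rewrite lee_fin.
have VE n : Vfun mu nu zeta n =
    \sum_(i < n) (mu i * zeta + nu i * zeta ^+ 2 / 2).
  rewrite big_split /= -!mulr_suml /Vfun /avg.
  (* For [n = 0] the division in [avg] cannot be cancelled, but both sides vanish. *)
  case: n => [|n]; first by rewrite !big_ord0; ring.
  by field; rewrite ?pnatr_eq0.
have prodE n w : \prod_(i < n) phi i (X i w) = c * expR (g n w).
  rewrite /c -expRD /phi -expR_sum; congr expR.
  by rewrite sumrB -mulr_sumr -VE /g /S; ring.
have avgnu0 := avg_gt0 nu0 m0.
have -> : expR (- (`|theta - avg mu m| ^+ 2) / (2 * avg nu m)) ^+ m = c^-1.
  rewrite -expRM_natl -expRN real_normK ?num_real//; congr expR.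
  (* With this [zeta] the exponent of [c] equals [m * (theta - avg mu m)^2 / (2 * avg nu m)]. *)
  by rewrite /Vfun /zeta; field; rewrite gt_eqF.
have mE : measurable E.
  rewrite -[X in measurable X]setTI; apply: emeasurable_fun_c_infty => //.
  (* The supremum over positive [n] is the tail supremum from index 1. *)
  apply: (@measurable_fun_esups _ _ _ _ (fun n w => (g n w)%:E)) => n.
  apply/measurable_EFinP; rewrite /g.
  apply: measurable_funD => //; apply: measurable_funB => //.
  apply: measurable_funM => //; apply: measurable_funB => //.
  exact: measurable_sum.
have PE e : 0 < e -> e < c -> (P E <= (e^-1)%:E)%E.
  move=> e0 ec; apply: (le_trans _ (ville_inequality indepX mphi phi0 phi1 e0)).
  apply: le_measure; rewrite ?inE//.
    apply: bigcupT_measurable => n; apply: measurable_superlevel.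
    by apply: measurable_prod => i _; exact: measurableT_comp.
  move=> w Ew.
  (* A nonnegative supremum exceeds this negative level, so some term does too, whether or not the
     supremum is attained. *)
  have lnlt0 : ((ln (e / c))%:E < 0)%E.
    by rewrite lte_fin ln_lt0// divr_gt0//= ltr_pdivrMr// mul1r.
  have /ereal_sup_gt[_ [n _ <-]] := lt_le_trans lnlt0 Ew.
  rewrite lte_fin => gn; exists n => //=.
  rewrite prodE -ler_pdivrMl// mulrC -[leLHS]lnK ?ler_expR ?posrE ?divr_gt0//.
  exact: ltW.
have PEfin : P E \is a fin_num by exact: fin_num_measure.
rewrite -(fineK PEfin) lee_fin.
(* If [P E] exceeded [c^-1], the midpoint [e] of [(P E)^-1] and [c] would give
   [P E <= e^-1 < P E]. *)
rewrite leNgt; apply/negP => cp.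
have p0 : 0 < fine (P E) by apply: lt_trans cp; rewrite invr_gt0.
have pc : (fine (P E))^-1 < c by rewrite -[c]invrK ltf_pV2// posrE invr_gt0.
have [pe ec] := midf_lt pc.
have e0 : 0 < ((fine (P E))^-1 + c) / 2 by apply: lt_trans pe; rewrite invr_gt0.
have := PE _ e0 ec; rewrite -(fineK PEfin) lee_fin.
by rewrite -[leLHS]invrK lef_pV2 ?posrE ?invr_gt0// leNgt pe.
Qed.
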